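(* Let $r\in\mathbb{N}$ and let $\mu_1,\ldots,\mu_r$ be complex measures, all of whose moments exist, which form a weakly complete system. Let $P_n$ be the corresponding monic type II multiple orthogonal polynomials for proper multi-indices, and let $\vec A_n$ be the corresponding normalized type I multiple orthogonal vector polynomials. Let $Q^{(i)}_{k,n}$ and $\gamma_n$ be defined from these as in the context. Then for every $n\in\mathbb{N}$ and every $i=1,\ldots,\min(r,n)$, $$(x-y)\sum_{k=1}^nP_{k-1}(x)\,Q^{(i)}_{k,n}(y)=\gamma_n\Bigl(P_n(x)P_{n-i}(y)-P_n(y)P_{n-i}(x)\Bigr)$$ and $$\sum_{k=1}^nP_{k-1}(x)\,Q^{(i)}_{k,n}(x)=\gamma_n\Bigl(P_n'(x)P_{n-i}(x)-P_n(x)P_{n-i}'(x)\Bigr).$$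
   Context: Notation: $\mathbb{N}=\{1,2,\ldots\}$, $\mathbb{N}_0=\mathbb{N}\cup\{0\}$; $\Gamma_j$ is the support of $\mu_j$. For $n\in\mathbb{N}_0$ write $n=mr+s$ with $0<s\le r$ ($m,s$ integers). The proper multi-index corresponding to $n$ is $\vec\nu_n=(m+1,\ldots,m+1,m,\ldots,m)\in\mathbb{N}_0^r$, with $s$ entries $m+1$ followed by $r-s$ entries $m$; $\vec\nu_n(j)$ is its $j$th component. Type II polynomials: a type II multiple orthogonal polynomial for $\vec\nu_n$ is a (nonzero) polynomial $P_n$ of degree at most $n$ with $\int_{\Gamma_j}P_n(x)x^\ell\,d\mu_j(x)=0$ for $\ell=0,\ldots,\vec\nu_n(j)-1$, $j=1,\ldots,r$. The multi-index $\vec\nu_n$ is normal if every such nonzero polynomial has exact degree $n$ (equivalently, the solution is unique up to a scalar factor and has exact degree $n$). The measures form a weakly complete system if all $\vec\nu_n$, $n\in\mathbb{N}$, are normal. In that case $P_n$ denotes the unique monic type II polynomial ($P_0\equiv1$, and $P_j\equiv0$ for $j<0$). Type I polynomials: for $n\ge1$, $\vec A_n=(A_{n,1},\ldots,A_{n,r})^T$ is the unique vector of polynomials, with $A_{n,j}$ of degree at most $\vec\nu_n(j)-1$ (so $A_{n,j}=0$ if $\vec\nu_n(j)=0$), satisfying $$\int x^\ell\sum_{j=1}^rA_{n,j}(x)\,d\mu_j(x)=0,\quad \ell=0,\ldots,n-2,\qquad \int x^{n-1}\sum_{j=1}^rA_{n,j}(x)\,d\mu_j(x)=1.$$ Also $\vec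 A_0\equiv\vec0$. For $1\le j\le r$, $A_{j,j}$ is a nonzero constant. Recurrence coefficients: for a weakly complete system there are unique $a_{n,j}\in\mathbb{C}$, $0\le j\le\min(r,n)$, such that $$xP_n(x)=P_{n+1}(x)+\sum_{j=0}^{r}a_{n,j}P_{n-j}(x),\quad n\ge0,\qquad x\vec A_n(x)=\vec A_{n-1}(x)+\sum_{j=0}^ra_{n+j-1,j}\vec A_{n+j}(x),\quad n\ge1,$$ and $a_{\ell,r}\ne0$ for $\ell\ge r$. By convention $a_{\ell_1,\ell_2}=1$ for $0\le\ell_1<\ell_2\le r$ in the definition of the $\vec B_n^{(i)}$ below. The polynomials $\vec B_n^{(i)}$ and $Q^{(i)}_{k,n}$: for $n\in\mathbb{N}$ and $i=1,\ldots,r$, $$\vec B_n^{(i)}(x)=\sum_{j=i}^{r}a_{n-i+j,j}\,\vec A_{n-i+j+1}(x),$$ which for $i\le n$ also equals $x\vec A_{n-i+1}(x)-\vec A_{n-i}(x)-\sum_{j=0}^{i-1}a_{n+j-i,j}\vec A_{n-i+j+1}(x)$. For $n\in\mathbb{N}$, $i=1,\ldots,\min(r,n)$ and $k\in\mathbb{N}$, $$Q^{(i)}_{k,n}(x)=\det\Bigl(\vec B_n^{(1)}(x)\ \cdots\ \vec B_n^{(i-1)}(x)\ \ \vec A_k(x)\ \ \vec B_n^{(i+1)}(x)\ \cdots\ \vec B_n^{(r)}(x)\Bigr),$$ the determinant of the $r\times r$ matrix with the indicated columns. The constant $\gamma_n$: for $n=mr+s$, $0<s\le r$, $$\gamma_n=\frac{\prod_{j=1}^rA_{j,j}}{\prod_{\ell=r}^{n-1}a_{\ell,r}}\,(-1)^{\lfloor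 s/2\rfloor+\lfloor (r-s)/2\rfloor},$$ with empty products equal to $1$. *)

(* Defs.v *)
From HB Require Import structures.
From mathcomp Require Import all_boot all_order all_algebra.
From mathcomp Require Import complex.
From mathcomp Require Import all_classical all_reals all_analysis.

Set Implicit Arguments.
Unset Strict Implicit.
Unset Printing Implicit Defensive.

Import Order.TTheory GRing.Theory Num.Theory.
Import numFieldNormedType.Exports.

Local Open Scope classical_set_scope.
Local Open Scope complex_scope.
Local Open Scope ring_scope.

Lemma nbhs_EFin_dist (K : numFieldType) (l e : K) : 0 < e ->
  nbhs l%:E [set y : \bar K | `|l - fine y| < e].
Proof. by move=> e0; exact: (@nbhsx_ballx K K l e e0). Qed.

(* A complex measure is a charge with values in \bar R[i]: it is finite on
   measurable sets and countably additive for the topology of R[i].  Its real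
   and imaginary parts are real charges. *)
Section complex_charge_parts.
Context d (T : measurableType d) (R : realType).
Variable mu : {charge set T -> \bar R[i]}.

Lemma part_semi_sigma_additive (phi : R[i] -> R) :
  phi 0 = 0 -> (forall x y, phi (x + y) = phi x + phi y) ->
  (forall x, `|phi x|%:C <= `|x|) ->
  measure_function.semi_sigma_additive
    (fun A : set T => (phi (fine (mu A)))%:E).
Proof.
move=> phi0 phiD phi_le F mF tF mUF.
have phiB x y : phi x - phi y = phi (x - y).
  by apply/eqP; rewrite subr_eq -phiD subrK.
have fF i : mu (F i) \is a fin_num by rewrite fin_num_measure.
have mu_sum n : (\sum_(0 <= i < n) (phi (fine (mu (F i))))%:E)%E =
    (phi (fine (\sum_(0 <= i < n) mu (F i))%E))%:E.
  rewrite sumEFin; congr (_%:E).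
  under [in RHS]eq_bigr do rewrite -(fineK (fF _)).
  by rewrite sumEFin /= (big_morph phi phiD phi0).
under eq_fun do rewrite mu_sum.
have h := @charge_semi_sigma_additive _ _ _ mu F mF tF mUF.
set l := mu (\bigcup_n F n) in h *.
have lE : l = (fine l)%:E by rewrite fineK// fin_num_measure.
rewrite {}lE in h *.
suff : phi (fine (\sum_(0 <= i < n) mu (F i))%E) @[n --> \oo] --> phi (fine l).
  by move=> + A nA => /(_ _ nA).
apply/cvgrPdist_lt => e e0.
have : nbhs (fine l)%:E [set y : \bar R[i] | `|fine l - fine y| < e%:C].
  by apply: nbhs_EFin_dist; rewrite ltcR.
move/h; apply: (@filterS _ \oo _) => n le_e.
by rewrite -ltcR phiB; exact: le_lt_trans (phi_le _) le_e.
Qed.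

Definition charge_Re (A : set T) : \bar R := (complex.Re (fine (mu A)))%:E.
Definition charge_Im (A : set T) : \bar R := (complex.Im (fine (mu A)))%:E.

Let charge_Re0 : charge_Re set0 = 0%E.
Proof. by rewrite /charge_Re charge0. Qed.

Let charge_Re_fin A : measurable A -> charge_Re A \is a fin_num.
Proof. by []. Qed.

Let charge_Re_sigma_additive :
  measure_function.semi_sigma_additive charge_Re.
Proof.
apply: part_semi_sigma_additive => //; first by move=> [? ?] [? ?].
exact: normc_ge_Re.
Qed.

HB.instance Definition _ := isCharge.Build _ _ _ charge_Re
  charge_Re0 charge_Re_fin charge_Re_sigma_additive.

Let charge_Im0 : charge_Im set0 = 0%E.
Proof. by rewrite /charge_Im charge0. Qed.

Let charge_Im_fin A : measurable A -> charge_Im A \is a fin_num.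
Proof. by []. Qed.

Let charge_Im_sigma_additive :
  measure_function.semi_sigma_additive charge_Im.
Proof.
apply: part_semi_sigma_additive => //; first by move=> [? ?] [? ?].
move=> x; rewrite normc_def lecR -sqrtr_sqr ler_sqrt ?addr_ge0 ?sqr_ge0//.
by rewrite lerDr sqr_ge0.
Qed.

HB.instance Definition _ := isCharge.Build _ _ _ charge_Im
  charge_Im0 charge_Im_fin charge_Im_sigma_additive.

End complex_charge_parts.

(* The library integrates against measures only: a real charge is integrated
   through its Jordan decomposition, which does not depend on the chosen Hahn
   decomposition. *)
Section charge_integral.
Context d (T : measurableType d) (R : realType).
Variable nu : {charge set T -> \bar R}.

Definition hahn_pos : set T := sval (cid (Hahn_decomposition nu)).
Definition hahn_neg : set T := sval (cid (svalP (cid (Hahn_decomposition nu)))).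

Lemma hahn_decompositionP : hahn_decomposition nu hahn_pos hahn_neg.
Proof. exact: svalP (cid (svalP (cid (Hahn_decomposition nu)))). Qed.

Definition charge_integrable (f : T -> R) : Prop :=
  (charge_variation hahn_decompositionP).-integrable setT (EFin \o f).

Definition charge_integral (f : T -> R) : R :=
  \int[jordan_pos hahn_decompositionP]_x f x
  - \int[jordan_neg hahn_decompositionP]_x f x.

End charge_integral.

Section complex_integral.
Context d (T : measurableType d) (R : realType).
Variable mu : {charge set T -> \bar R[i]}.

(* Equivalent to integrability for the total variation |mu|, since
   |Re mu|, |Im mu| <= |mu| <= |Re mu| + |Im mu|. *)
Definition complex_integrable (f : T -> R[i]) : Prop :=
  [/\ charge_integrable (charge_Re mu) (fun x => complex.Re (f x)),
      charge_integrable (charge_Re mu) (fun x => complex.Im (f x)),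
      charge_integrable (charge_Im mu) (fun x => complex.Re (f x)) &
      charge_integrable (charge_Im mu) (fun x => complex.Im (f x))].

Definition complex_integral (f : T -> R[i]) : R[i] :=
  (charge_integral (charge_Re mu) (fun x => complex.Re (f x))
   - charge_integral (charge_Im mu) (fun x => complex.Im (f x)))
  +i* (charge_integral (charge_Re mu) (fun x => complex.Im (f x))
       + charge_integral (charge_Im mu) (fun x => complex.Re (f x))).

End complex_integral.

(* The complex plane with its Borel sigma-algebra, in real coordinates: R[i]
   has no measurable structure in the library.  A measure on the real line is
   the case of a measure carried by [set p | p.2 = 0]. *)
Definition plane (R : realType) := (measurableTypeR R * measurableTypeR R)%type.

Definition plane_point (R : realType) (p : plane R) : R[i] := p.1 +i* p.2.

Section multiple_orthogonality.
Variables (R : realType) (r : nat).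

Definition all_moments_exist (mu : {charge set (plane R) -> \bar R[i]}) : Prop :=
  forall l : nat, complex_integrable mu (fun p => plane_point p ^+ l).

Definition poly_integral (mu : {charge set (plane R) -> \bar R[i]})
    (q : {poly R[i]}) : R[i] :=
  complex_integral mu (fun p => q.[plane_point p]).

(* For n = m * r + s with 0 < s <= r. If n > 0 then m = n.-1 %/ r and
   s = (n.-1 %% r).+1; if n = 0 then m = -1, s = r and every entry is 0.
   The index j is counted from 0. *)
Definition quot_part (n : nat) : nat := n.-1 %/ r.
Definition rem_part (n : nat) : nat := (n.-1 %% r).+1.

Definition proper_index (n j : nat) : nat :=
  if n == 0%N then 0%N
  else if (j < rem_part n)%N then (quot_part n).+1 else quot_part n.

Variable mu : 'I_r -> {charge set (plane R) -> \bar R[i]}.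

Definition typeII (n : nat) (p : {poly R[i]}) : Prop :=
  [/\ p != 0, (size p <= n.+1)%N &
      forall (j : 'I_r) (l : nat), (l < proper_index n j)%N ->
        poly_integral (mu j) (p * 'X^l) = 0].

Definition normal_index (n : nat) : Prop :=
  forall p, typeII n p -> size p = n.+1.

Definition weakly_complete : Prop :=
  forall n, (0 < n)%N -> normal_index n.

Definition monic_typeII (n : nat) (p : {poly R[i]}) : Prop :=
  typeII n p /\ p \is monic.

Definition typeI (n : nat) (A : 'cV[{poly R[i]}]_r) : Prop :=
  [/\ forall j : 'I_r, (size (A j ord0) <= proper_index n j)%N,
      forall l : nat, (l.+1 < n)%N ->
        \sum_(j < r) poly_integral (mu j) ('X^l * A j ord0) = 0 &
      \sum_(j < r) poly_integral (mu j) ('X^(n.-1) * A j ord0) = 1].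

(* The recurrence relation of the P_n determines a n j for j <= minn r n; the
   other entries with j <= r follow the convention a n j = 1. *)
Definition recurrence_coefficients
    (P : nat -> {poly R[i]}) (a : nat -> nat -> R[i]) : Prop :=
  (forall n, 'X * P n =
     P n.+1 + \sum_(0 <= j < (minn r n).+1) a n j *: P (n - j)%N) /\
  (forall n j, (n < j <= r)%N -> a n j = 1).

Variables (A : nat -> 'cV[{poly R[i]}]_r) (a : nat -> nat -> R[i]).

Definition Bvec (n i : nat) : 'cV[{poly R[i]}]_r :=
  \sum_(i <= j < r.+1) (a (n + j - i)%N j)%:P *: A (n + j - i).+1.

(* The column of index c, counted from 0, holds the (c + 1)-st vector. *)
Definition Qpoly (i k n : nat) : {poly R[i]} :=
  \det (\matrix_(l < r, c < r)
          (if c.+1 == i then A k l ord0 else Bvec n c.+1 l ord0)).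

(* A j.+1 j ord0 is constant: `_0 extracts its value. *)
Definition gamma (n : nat) : R[i] :=
  (\prod_(j < r) (A j.+1 j ord0)`_0) / (\prod_(r <= l < n) a l r)
  * (-1) ^+ ((rem_part n)./2 + (r - rem_part n)./2).

End multiple_orthogonality.

(* Main.v *)
(* Pairing the two recurrences gives
     (x - y) sum_k P_(k-1)(x) A_k(y)
       = P_n(x) A_n(y) - sum_i P_(n-i)(x) B_n^(i)(y).
   Replacing the i-th column of M_n = (B_n^(1) ... B_n^(r)) by both sides and
   taking determinants turns this into
     (x - y) sum_k P_(k-1)(x) Q^(i)_(k,n)(y)
       = P_n(x) Q^(i)_(n,n)(y) - P_(n-i)(x) det M_n(y),
   and x = y yields P_n Q^(i)_(n,n) = P_(n-i) det M_n, so that it remains to see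
   that det M_n = gamma_n P_n.  For i = 1 column operations give
   a_(n-1,r) Q^(1)_(n,n) = (-1)^(r-1) det M_(n-1), whence a recursion in n for
   det M_n / P_n; it starts from n = 0, where M_0 is antitriangular with constant
   antidiagonal entries A_(j,j).  The second identity is the derivative of the
   first one in x at x = y. *)
From HB Require Import structures.
Require Import Defs.
From mathcomp Require Import all_boot all_order all_algebra.
From mathcomp Require Import complex zify ring.
From mathcomp Require Import all_classical all_reals all_analysis.
From mathcomp Require Import measurable_realfun.

Set Implicit Arguments.
Unset Strict Implicit.
Unset Printing Implicit Defensive.

Import Order.TTheory GRing.Theory Num.Theory.
Local Open Scope complex_scope.
Local Open Scope ring_scope.

(** * Linearity of the integral *)

Section charge_integral_linear.
Context d (T : measurableType d) (R : realType).
Implicit Types (nu : {charge set T -> \bar R}) (f g : T -> R).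

(** The variation is the sum of the two Jordan parts as measures, so the integral of [|f|] against
    either part is at most the finite total. *)
Lemma charge_integrable_jordan nu f : charge_integrable nu f ->
  (jordan_pos (hahn_decompositionP nu)).-integrable setT (EFin \o f) /\
  (jordan_neg (hahn_decompositionP nu)).-integrable setT (EFin \o f).
Proof.
move=> /integrableP[mf].
have -> : charge_variation (hahn_decompositionP nu) =
    measure_add (jordan_pos (hahn_decompositionP nu))
                (jordan_neg (hahn_decompositionP nu)) :> (set T -> \bar R).
  by apply/funext => B; rewrite measure_addE.
rewrite ge0_integral_measure_add//; last first.
  exact: measurableT_comp.
move=> fin; split; apply/integrableP; split=> //; apply: le_lt_trans fin.
  by rewrite leeDl// integral_ge0.
by rewrite leeDr// integral_ge0.
Qed.

Lemma charge_integrable_lin nu c f g : charge_integrable nu f ->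
  charge_integrable nu g -> charge_integrable nu (fun x => c * f x + g x).
Proof.
move=> nuf nug; rewrite /charge_integrable.
rewrite (_ : EFin \o _ =
  (fun x => c%:E * (EFin \o f) x)%E \+ (EFin \o g))%E; last exact/funext.
by apply: integrableD => //; exact: integrableZl.
Qed.

Lemma charge_integral_lin nu c f g : charge_integrable nu f ->
  charge_integrable nu g ->
  charge_integral nu (fun x => c * f x + g x) =
  c * charge_integral nu f + charge_integral nu g.
Proof.
move=> /charge_integrable_jordan[pf nf] /charge_integrable_jordan[pg ng].
have Zint (m : {measure set T -> \bar R}) : m.-integrable setT (EFin \o f) ->
    m.-integrable setT (EFin \o (fun x => c * f x)).
  by move=> mf; exact: (integrableZl measurableT c mf).
rewrite /charge_integral !RintegralD ?RintegralZl//; try exact: Zint.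
by rewrite mulrBr opprD addrACA.
Qed.

End charge_integral_linear.

Section complex_integral_linear.
Context d (T : measurableType d) (R : realType).
Variable mu : {charge set T -> \bar R[i]}.
Implicit Types (f g : T -> R[i]) (c : R[i]).

Lemma complex_integrable_lin c f g : complex_integrable mu f ->
  complex_integrable mu g -> complex_integrable mu (fun x => c * f x + g x).
Proof.
case: c => p q [f1 f2 f3 f4] [g1 g2 g3 g4].
have ReE x : complex.Re ((p +i* q) * f x + g x) =
    p * complex.Re (f x) + (- q * complex.Im (f x) + complex.Re (g x)).
  by case: (f x) (g x) => [? ?] [? ?] /=; rewrite mulNr addrA.
have ImE x : complex.Im ((p +i* q) * f x + g x) =
    p * complex.Im (f x) + (q * complex.Re (f x) + complex.Im (g x)).
  by case: (f x) (g x) => [? ?] [? ?] /=; rewrite addrA.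
split; under eq_fun do rewrite ?ReE ?ImE;
  by do 2![apply: charge_integrable_lin => //].
Qed.

Lemma complex_integral_lin c f g : complex_integrable mu f ->
  complex_integrable mu g ->
  complex_integral mu (fun x => c * f x + g x) =
  c * complex_integral mu f + complex_integral mu g.
Proof.
case: c => p q [f1 f2 f3 f4] [g1 g2 g3 g4]; rewrite /complex_integral.
have ReE : (fun x => complex.Re ((p +i* q) * f x + g x)) =
    (fun x => p * complex.Re (f x) + (- q * complex.Im (f x) + complex.Re (g x))).
  by apply/funext => x; case: (f x) (g x) => [? ?] [? ?] /=; rewrite mulNr addrA.
have ImE : (fun x => complex.Im ((p +i* q) * f x + g x)) =
    (fun x => p * complex.Im (f x) + (q * complex.Re (f x) + complex.Im (g x))).
  by apply/funext => x; case: (f x) (g x) => [? ?] [? ?] /=; rewrite addrA.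
rewrite ReE ImE !charge_integral_lin//; try exact: charge_integrable_lin.
by apply/eqP; rewrite eq_complex /=; apply/andP; split; apply/eqP; ring.
Qed.

Lemma complex_integrable0 : complex_integrable mu (fun=> 0).
Proof.
by split; rewrite /charge_integrable/=; apply: integrable0.
Qed.

End complex_integral_linear.

Section poly_integral_linear.
Variables (R : realType) (mu : {charge set (plane R) -> \bar R[i]}).
Hypothesis moments_mu : all_moments_exist mu.

Lemma complex_integrable_poly (q : {poly R[i]}) :
  complex_integrable mu (fun p => q.[plane_point p]).
Proof.
under eq_fun do rewrite horner_coef.
elim: (size q) => [|n IHn].
  under eq_fun do rewrite big_ord0.
  exact: complex_integrable0.
under eq_fun do rewrite big_ord_recr/= addrC.
exact: complex_integrable_lin.
Qed.

Lemma poly_integral_is_linear : linear_for *%R (poly_integral mu).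
Proof.
move=> c p q; rewrite /poly_integral.
under [in LHS]eq_fun do rewrite hornerD hornerZ.
exact: complex_integral_lin (complex_integrable_poly p) (complex_integrable_poly q).
Qed.

(** Packs the functional as a linear map; the later algebra sees the measures only through such
    maps. *)
Lemma poly_integral_linear : exists L : {linear {poly R[i]} -> R[i] | *%R},
  poly_integral mu = L :> (_ -> _).
Proof.
pose f : {poly R[i]} -> R[i] := poly_integral mu.
pose L : {linear {poly R[i]} -> R[i] | *%R} :=
  HB.pack f (GRing.isLinear.Build _ _ _ _ f poly_integral_is_linear).
by exists L.
Qed.

End poly_integral_linear.

(** * Biorthogonality and the recurrence of the type I vectors *)

(** Ranks the pairs [(l, j)] by [l * r + j]: passing from [n] to [n.+1] admits exactly one new
    vector monomial, the one of rank [n]. *)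
Lemma ltn_proper_index r n j l : (j < r)%N ->
  (l < proper_index r n j)%N = (l * r + j < n)%N.
Proof.
move=> ltjr; rewrite /proper_index /rem_part /quot_part.
case: n => [|n] /=; first by rewrite !ltn0.
have r_gt0 : (0 < r)%N by apply: leq_ltn_trans ltjr.
have := divn_eq n r; have := ltn_pmod n r_gt0.
move: (n %/ r)%N (n %% r)%N => q s lt_sr ->.
case: (ltngtP l q) => [ltlq|ltql|->]; case: ifP => /= js.
- by rewrite ltnS ltnW//; symmetry; nia.
- by rewrite ltlq; symmetry; nia.
- by rewrite ltnS leqNgt ltql; symmetry; apply/negbTE; nia.
- by rewrite ltnNge ltnW//; symmetry; apply/negbTE; nia.
- by rewrite ltnSn; symmetry; nia.
- by rewrite ltnn; symmetry; apply/negbTE; nia.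
Qed.

Section biorthogonality.
Variables (R : realType) (r' : nat).
Local Notation r := r'.+1.
Local Notation C := R[i].
Implicit Types (p q : {poly C}) (A B D : 'cV[{poly C}]_r).

(* vcoef k is the coefficient on the vector monomial X^(k %/ r) e_(k %% r).  In
   this order the first N monomials span exactly the vectors whose component
   degrees are allowed by the multi-index of N, so these spaces form a full flag
   and multiplication by X is a shift by r. *)
Definition vcoef k A : C := (A (inZp k) ord0)`_(k %/ r).

Definition vsize_le N A := forall k, (N <= k)%N -> vcoef k A = 0.

Lemma vcoef_ord l (j : 'I_r) A : vcoef (l * r + j) A = (A j ord0)`_l.
Proof.
rewrite /vcoef divnMDl// divn_small// addn0 (_ : inZp _ = j)//.
by apply/val_inj; rewrite /= modnMDl modn_small.
Qed.

Lemma vcoef_lin k (c : C) A B :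
  vcoef k (c%:P *: A + B) = c * vcoef k A + vcoef k B.
Proof. by rewrite /vcoef !mxE coefD coefCM. Qed.

Lemma vcoefMX k A : vcoef (k + r) ('X *: A) = vcoef k A.
Proof.
rewrite /vcoef !mxE coefXM divnDr ?dvdnn// divnn/= addn1/=.
by rewrite (_ : inZp (k + r) = inZp k)//; apply/val_inj; rewrite /= modnDr.
Qed.

Lemma vsize_le_lin N (c : C) A B : vsize_le N A -> vsize_le N B ->
  vsize_le N (c%:P *: A + B).
Proof. by move=> hA hB k Nk; rewrite vcoef_lin hA// hB// mulr0 addr0. Qed.

Lemma vsize_leW M N A : (M <= N)%N -> vsize_le M A -> vsize_le N A.
Proof. by move=> MN hA k /(leq_trans MN); exact: hA. Qed.

Lemma vsize_le0 A : vsize_le 0 A -> A = 0.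
Proof.
move=> hA; apply/matrixP => j c; rewrite ord1 !mxE; apply/polyP => l.
by rewrite coef0 -vcoef_ord hA.
Qed.

Lemma vsize_leMX N A : vsize_le N A -> vsize_le (N + r) ('X *: A).
Proof.
move=> hA k Nk; rewrite -(subnK (leq_trans (leq_addl N r) Nk)) vcoefMX hA//.
lia.
Qed.

Lemma vsize_le_proper N A : (forall j, size (A j ord0) <= proper_index r N j)%N ->
  vsize_le N A.
Proof.
move=> hA k Nk; rewrite /vcoef; apply: nth_default; apply: leq_trans (hA _) _.
rewrite leqNgt ltn_proper_index; last exact: ltn_ord.
by rewrite -leqNgt (leq_trans Nk)// {1}(divn_eq k r).
Qed.

(** * The pairing of polynomials with vectors, and biorthogonality *)

Variable L : 'I_r -> {linear {poly C} -> C | *%R}.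

Definition pairing p A : C := \sum_(j < r) L j (p * A j ord0).

Lemma pairing_linl c p q A :
  pairing (c *: p + q) A = c * pairing p A + pairing q A.
Proof.
rewrite /pairing mulr_sumr -big_split; apply: eq_bigr => j _ /=.
by rewrite mulrDl -scalerAl linearP.
Qed.

Lemma pairing_linr (c : C) p A B :
  pairing p (c%:P *: A + B) = c * pairing p A + pairing p B.
Proof.
rewrite /pairing mulr_sumr -big_split; apply: eq_bigr => j _ /=.
by rewrite !mxE mulrDr mul_polyC -scalerAr linearP.
Qed.

Lemma pairing0l A : pairing 0 A = 0.
Proof. by rewrite /pairing big1// => j _; rewrite mul0r linear0. Qed.

Lemma pairing0r p : pairing p 0 = 0.
Proof. by rewrite /pairing big1// => j _; rewrite mxE mulr0 linear0. Qed.

Lemma pairingDl p q A : pairing (p + q) A = pairing p A + pairing q A.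
Proof. by rewrite -[p]scale1r pairing_linl scale1r mul1r. Qed.

Lemma pairingDr p A B : pairing p (A + B) = pairing p A + pairing p B.
Proof. by rewrite -[A]scale1r -polyC1 pairing_linr polyC1 scale1r mul1r. Qed.

Lemma pairing_suml (I : Type) (s : seq I) (c : I -> C) (p : I -> {poly C}) A :
  pairing (\sum_(i <- s) c i *: p i) A = \sum_(i <- s) c i * pairing (p i) A.
Proof.
elim: s => [|i s IHs]; first by rewrite !big_nil pairing0l.
by rewrite !big_cons pairing_linl IHs.
Qed.

Lemma pairing_sumr (I : Type) (s : seq I) (c : I -> C) p (A : I -> 'cV_r) :
  pairing p (\sum_(i <- s) (c i)%:P *: A i) = \sum_(i <- s) c i * pairing p (A i).
Proof.
elim: s => [|i s IHs]; first by rewrite !big_nil pairing0r.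
by rewrite !big_cons pairing_linr IHs.
Qed.

Lemma pairingMX p A : pairing ('X * p) A = pairing p ('X *: A).
Proof. by apply: eq_bigr => j _; rewrite mxE mulrCA mulrA. Qed.

Variables (P : nat -> {poly C}) (A : nat -> 'cV[{poly C}]_r).
Hypothesis sizeP : forall n, size (P n) = n.+1.
Hypothesis monicP : forall n, P n \is monic.
Hypothesis orthoP : forall n (j : 'I_r) l, (l < proper_index r n j)%N ->
  L j (P n * 'X^l) = 0.
Hypothesis A0 : A 0 = 0.
Hypothesis sizeA : forall n, vsize_le n (A n).
Hypothesis dualA : forall n l, (l <= n)%N -> pairing 'X^l (A n.+1) = (l == n)%:R.

(** Expand [D] in vector monomials: those of rank below [n] are killed by orthogonality, the others
    have coefficient 0. *)
Lemma pairing_ortho n D : vsize_le n D -> pairing (P n) D = 0.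
Proof.
move=> hD; rewrite /pairing big1// => j _.
rewrite -[D j _]coefK poly_def mulr_sumr linear_sum big1//= => l _.
rewrite -scalerAr linearZ /=.
have [ltn|len] := ltnP (l * r + j) n.
  by rewrite orthoP ?mulr0// ltn_proper_index.
by have := hD _ len; rewrite vcoef_ord => ->; rewrite mul0r.
Qed.

(** For [n < m] the orthogonality of [P m] applies; for [m <= n] that of [A n.+1] leaves at most the
    leading term of the monic [P m]. *)
Lemma pairing_dual m n : pairing (P m) (A n.+1) = (m == n)%:R.
Proof.
have [lenm|ltnm] := ltnP n m.
  by rewrite gtn_eqF// (pairing_ortho (vsize_leW lenm (@sizeA n.+1))).
rewrite -[P m]coefK poly_def sizeP pairing_suml big_ord_recr/=.
have lead1 : (P m)`_m = 1 by have /eqP := monicP m; rewrite lead_coefE sizeP.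
rewrite lead1 mul1r dualA// big1 ?add0r// => l _; rewrite dualA.
  by rewrite ltn_eqF ?mulr0//; apply: leq_trans ltnm.
by apply: ltnW; apply: leq_trans ltnm.
Qed.

(** Otherwise [A n.+1] would lie in the [n]-th space of the flag, hence be orthogonal to [P n]. *)
Lemma vcoef_dual_neq0 n : vcoef n (A n.+1) != 0.
Proof.
apply/eqP => A_0; have : pairing (P n) (A n.+1) = 0.
  apply: pairing_ortho => k; rewrite leq_eqVlt => /orP[/eqP<-//|].
  exact: sizeA.
by rewrite pairing_dual eqxx => /eqP; rewrite oner_eq0.
Qed.

Lemma vsize_le_pred n D : vsize_le n.+1 D -> pairing (P n) D = 0 ->
  vsize_le n D.
Proof.
move=> hD PD0.
(* Chosen to cancel the top coefficient of [D]; pairing the result with [P n] then forces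
   [c = 0]. *)
pose c := - (vcoef n D / vcoef n (A n.+1)).
have hE : vsize_le n (c%:P *: A n.+1 + D).
  move=> k; rewrite leq_eqVlt => /orP[/eqP<-|]; last first.
    exact: (vsize_le_lin c (@sizeA n.+1) hD).
  by rewrite vcoef_lin /c mulNr divfK ?vcoef_dual_neq0// addNr.
have := pairing_ortho hE; rewrite pairing_linr pairing_dual eqxx PD0.
rewrite mulr1 addr0 => c0 k; rewrite leq_eqVlt => /orP[/eqP<-|]; last exact: hD.
move/eqP: c0; rewrite /c oppr_eq0 mulf_eq0 invr_eq0.
by rewrite (negbTE (vcoef_dual_neq0 n)) orbF => /eqP.
Qed.

Lemma pairing_nondegenerate n D : vsize_le n D ->
  (forall m, pairing (P m) D = 0) -> D = 0.
Proof.
elim: n => [hD _|n IHn hD PD]; first exact: vsize_le0.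
by apply: IHn => //; exact: vsize_le_pred.
Qed.

(** * Transfer of the recurrence from type II to type I *)

Variable a : nat -> nat -> C.
Hypothesis recP : recurrence_coefficients r P a.

(* Both sides lie in a space of the flag and have the same pairings with all
   the P m. *)
Lemma typeI_recurrence n :
  'X *: A n.+1 = A n + \sum_(0 <= j < r.+1) (a (n + j)%N j)%:P *: A (n + j).+1.
Proof.
apply/eqP; rewrite -subr_eq0 addrC -scaleN1r -polyC1 -polyCN; apply/eqP.
apply: (@pairing_nondegenerate (n + r).+1).
  apply: vsize_le_lin; last by rewrite -addSn; exact: vsize_leMX (@sizeA n.+1).
  rewrite -[A n]scale1r -polyC1; apply: vsize_le_lin.
    exact: vsize_leW (leq_trans (leq_addr r n) (leqnSn _)) (@sizeA n).
  rewrite big_mkord; apply: (big_ind (vsize_le (n + r).+1)).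
  - by move=> k _; rewrite /vcoef mxE coef0.
  - move=> x y hx hy; rewrite -[x]scale1r -polyC1.
    exact: vsize_le_lin.
  - move=> j _; rewrite -[_ *: _]addr0; apply: vsize_le_lin; last first.
      by move=> k _; rewrite /vcoef mxE coef0.
    by apply: vsize_leW (@sizeA _); rewrite ltnS leq_add2l -ltnS.
move=> m; rewrite pairing_linr -pairingMX recP.1 !pairingDl pairingDr.
rewrite pairing_suml pairing_sumr.
under eq_bigr do rewrite pairing_dual.
under [X in _ + (_ + X)]eq_bigr do rewrite pairing_dual.
rewrite pairing_dual (_ : pairing (P m) (A n) = (m.+1 == n)%:R); last first.
  by case: n => [|n]; rewrite ?A0 ?pairing0r ?pairing_dual.
suff -> : \sum_(0 <= j < (minn r m).+1) a m j * ((m - j)%N == n)%:R =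
    \sum_(0 <= j < r.+1) a (n + j)%N j * (m == (n + j)%N)%:R.
  by rewrite mulN1r addNr.
(* The guard [j <= m] must be kept: for [m < j] the truncated difference [m - j] is 0 and could
   equal [n]. *)
rewrite (@big_nat_widen _ _ _ 0 _ r.+1) ?ltnS ?geq_minl// big_mkcond.
apply: eq_big_nat => j /andP[_ ltjr]; rewrite /= ltnS leq_min -ltnS ltjr/=.
case: leqP => [lejm|ltmj].
  have [<-|neq] := eqVneq (m - j)%N n; first by rewrite subnK// eqxx.
  by rewrite !mulr0n; case: eqP => [mE|]; rewrite ?mulr0//; lia.
by case: eqP => [mE|]; rewrite ?mulr0//; lia.
Qed.

(** If [a n r = 0], then ['X *: A (n - r).+1] is orthogonal to [P n] and drops into the [n]-th
    space, although its coefficient of rank [n] is the nonzero top one of [A (n - r).+1]. *)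
Lemma leading_recurrence_neq0 n : (r <= n)%N -> a n r != 0.
Proof.
move=> len; apply/eqP => a0; have /eqP := vcoef_dual_neq0 (n - r); apply.
rewrite -vcoefMX subnK//.
have hX : vsize_le n.+1 ('X *: A (n - r).+1).
  by rewrite -[n.+1](@subnK r) ?(leqW len)// subSn//; exact: vsize_leMX (@sizeA _).
apply: (vsize_le_pred hX) => //.
rewrite -pairingMX recP.1 pairingDl pairing_dual pairing_suml.
rewrite (minn_idPl len) big_nat_recr//= a0 mul0r addr0.
rewrite gtn_eqF ?ltnS ?leq_subr// add0r big1_seq// => j.
rewrite mem_index_iota => /andP[_ /andP[_ ltjr]]; rewrite pairing_dual.
by rewrite gtn_eqF ?mulr0//; lia.
Qed.

End biorthogonality.

(** * Determinants, signs and polynomial identities *)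

(** Expanding along the last row leaves only column 0; the signs accumulate to the exponent
    [0 + 1 + ... + (n - 1)]. *)
Lemma det_antitrig (K : comPzRingType) n (M : 'M[K]_n) :
  (forall i j : 'I_n, (n <= i + j)%N -> M i j = 0) ->
  \det M = (-1) ^+ 'C(n, 2) * \prod_(i < n) M i (rev_ord i).
Proof.
elim: n => [|n IHn] in M * => M0; first by rewrite det_mx00 big_ord0 mulr1.
rewrite (expand_det_row M ord_max) (bigD1 ord0)//= big1 ?addr0 => [|j j0].
  rewrite /cofactor IHn => [|i j nij]; last first.
    by rewrite !mxE M0// lift_max lift0 addnS ltnS.
  rewrite binS bin1 exprD [in RHS]big_ord_recr/= expr0 mulr1 exprD.
  have -> : rev_ord (@ord_max n) = ord0 by apply/val_inj; rewrite /= subnn.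
  rewrite (eq_bigr (fun i : 'I_n => M (widen_ord (leqnSn n) i)
      (rev_ord (widen_ord (leqnSn n) i)))) => [|i _]; first by ring.
  rewrite !mxE; congr (M _ _); apply/val_inj; first exact: lift_max.
  by rewrite [LHS]lift0 /= subnSK.
by rewrite M0 ?mul0r//= -[X in (X < _)%N]addn0 ltn_add2l lt0n.
Qed.

(** Expansions along the moved column have the same minors, with cofactor signs differing by
    [(-1) ^+ n]. *)
Lemma det_rotate_col (K : comPzRingType) n (M N : 'M[K]_n.+1) :
  col' ord0 M = col' ord_max N -> col ord0 M = col ord_max N ->
  \det M = (-1) ^+ n * \det N.
Proof.
move=> MN' MN; rewrite (expand_det_col M ord0) (expand_det_col N ord_max).
rewrite mulr_sumr; apply: eq_bigr => i _.
have -> : M i ord0 = N i ord_max by have /matrixP/(_ i ord0) := MN; rewrite !mxE.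
rewrite /cofactor MN' addn0 exprD -[LHS]mul1r.
have sgn2 : (-1) ^+ n * (-1) ^+ n = 1 :> K by rewrite -exprMn mulrNN mulr1 expr1n.
by rewrite -{1}sgn2 /=; ring.
Qed.

Lemma odd_bin2 n : odd 'C(n, 2) = odd n./2.
Proof.
rewrite bin2 -{1 2}[n]odd_double_half; case: (odd n); last first.
  rewrite add0n -doubleMl doubleK oddM; case: n./2 => //= k.
  by rewrite odd_double andbT.
by rewrite add1n /= -doubleMr doubleK oddM /= odd_double.
Qed.

(** Matches the sign in [gamma] with that of [m * r + s] column rotations followed by an
    antitriangular determinant; [m] drops out because [r * r.-1] is even. *)
Lemma sign_rem r m s : (0 < s <= r)%N ->
  odd ((m * r + s) * r.-1 + 'C(r, 2)) = odd (s./2 + (r - s)./2).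
Proof.
move=> /andP[s0 sr]; rewrite oddD oddM oddD oddM odd_bin2.
have -> : odd r.-1 = ~~ odd r by lia.
case r_odd : (odd r); rewrite ?andbF ?andbT /=; lia.
Qed.

Lemma poly_eq_horner (K : numDomainType) (p q : {poly K}) :
  (forall x, p.[x] = q.[x]) -> p = q.
Proof.
move=> pq; apply/eqP; rewrite -subr_eq0; apply/negP => /negP pq0.
(* In characteristic 0 the natural numbers supply more distinct roots than the degree allows. *)
have := max_poly_roots pq0 (rs := [seq k%:R | k <- iota 0 (size (p - q))]).
rewrite size_map size_iota ltnn => h; suff: false by []; apply: h.
  by apply/allP => _ /mapP[k _ ->]; rewrite rootE !hornerE pq subrr.
by rewrite map_inj_uniq ?iota_uniq// => i j /eqP; rewrite eqr_nat => /eqP.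
Qed.

(** * The Christoffel-Darboux formula *)

Section christoffel_darboux.
Variables (R : realType) (r' : nat).
Local Notation r := r'.+1.
Local Notation C := R[i].
Variables (P : nat -> {poly C}) (A : nat -> 'cV[{poly C}]_r).
Variable a : nat -> nat -> C.
Hypothesis A0 : A 0 = 0.
Hypothesis recP : recurrence_coefficients r P a.
Hypothesis recA : forall n,
  'X *: A n.+1 = A n + \sum_(0 <= j < r.+1) (a (n + j)%N j)%:P *: A (n + j).+1.

(** Index 0 is not a column of the matrix, but it is needed to produce [B_(n+1)^(1)] by [BvecS]. *)
Lemma Bvec0 n : Bvec A a n 0 = 'X *: A n.+1 - A n.
Proof.
by rewrite recA addrC addKr; apply: eq_bigr => j _; rewrite subn0.
Qed.

Lemma Bvec_top n : Bvec A a n r = (a n r)%:P *: A n.+1.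
Proof. by rewrite /Bvec big_nat1 addnK. Qed.

Lemma Bvec_gt n : Bvec A a n r.+1 = 0.
Proof. by rewrite /Bvec big_geq. Qed.

Lemma BvecS n i : (i <= r)%N ->
  Bvec A a n.+1 i.+1 = Bvec A a n i - (a n i)%:P *: A n.+1.
Proof.
move=> ir; rewrite /Bvec [in RHS]big_ltn ?ltnS// addnK addrC addKr.
by apply: eq_bigr => j _; rewrite addSn subSS.
Qed.

(* The induction step is B_(n+1)^(i+1) = B_n^(i) - a_(n,i) A_(n+1) together with
   the two recurrences. *)
Lemma christoffel_darboux n l y :
  ('X - y%:P) * (\sum_(1 <= k < n.+1) (A k l ord0).[y] *: P k.-1) =
  (A n l ord0).[y] *: P n
  - \sum_(1 <= i < (minn r n).+1) (Bvec A a n i l ord0).[y] *: P (n - i)%N.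
Proof.
elim: n => [|n IHn].
  by rewrite minn0 !big_geq// A0 mxE horner0 scale0r mulr0 subr0.
rewrite big_nat_recr//= mulrDr IHn [in RHS]big_add1/=.
have -> : \sum_(0 <= i < minn r n.+1)
      (Bvec A a n.+1 i.+1 l ord0).[y] *: P (n.+1 - i.+1)%N =
    \sum_(0 <= i < (minn r n).+1)
      ((Bvec A a n i l ord0).[y] *: P (n - i)%N
       - (A n.+1 l ord0).[y] *: (a n i *: P (n - i)%N)).
  under [RHS]eq_big_nat => i /andP[_ ir].
    have {}ir : (i <= r)%N by apply: leq_trans (geq_minl r n).
    have -> : (Bvec A a n i l ord0).[y] *: P (n - i)%N
       - (A n.+1 l ord0).[y] *: (a n i *: P (n - i)%N) =
       (Bvec A a n.+1 i.+1 l ord0).[y] *: P (n.+1 - i.+1)%N.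
      by rewrite BvecS// !mxE !hornerE scalerBl scalerA mulrC subSS.
    over.
  (* For [n < r] both sums have [n + 1] terms; for [r <= n] the right one has an extra term, with
     the zero vector [B_(n+1)^(r+1)]. *)
  case: (ltnP n r) => [nr|rn]; first by rewrite (minn_idPr nr).
  rewrite (minn_idPl (leqW rn)) [RHS]big_nat_recr//= Bvec_gt.
  by rewrite mxE horner0 scale0r addr0.
rewrite sumrB -scaler_sumr [in RHS]big_ltn// Bvec0 subn0.
have -> : \sum_(0 <= i < (minn r n).+1) a n i *: P (n - i)%N = 'X * P n - P n.+1.
  by rewrite recP.1 addrC addKr.
rewrite !mxE hornerD hornerN hornerM hornerX -!mul_polyC polyCB polyCM.
by ring.
Qed.

(** * From vectors to determinants, by cofactors *)

Definition Bmx n : 'M[{poly C}]_r :=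
  \matrix_(l < r, c < r) Bvec A a n c.+1 l ord0.

(** The cofactors of a column do not involve that column, so the weights are independent of [k]. *)
Lemma Qpoly_cofactor (i : 'I_r) k n :
  Qpoly A a i.+1 k n = \sum_(l < r) A k l ord0 * cofactor (Bmx n) l i.
Proof.
rewrite /Qpoly (expand_det_col _ i); apply: eq_bigr => l _.
rewrite !mxE eqxx; congr (_ * (_ * \det _)); apply/matrixP => l' c.
by rewrite !mxE eqSS eq_sym /= (negbTE (neq_bump i c)).
Qed.

Lemma Bvec_cofactor (i c : 'I_r) n :
  \sum_(l < r) Bvec A a n c.+1 l ord0 * cofactor (Bmx n) l i =
  \det (Bmx n) *+ (i == c).
Proof.
have /matrixP/(_ i c) := mul_adj_mx (Bmx n); rewrite !mxE => <-.
by apply: eq_bigr => l _; rewrite !mxE mulrC.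
Qed.

(** Weight the component identities by the cofactors of column [i] and add: every other [B] column
    contributes 0 by [Bvec_cofactor]. *)
Lemma christoffel_darboux_Qpoly n (i : 'I_r) y : (i < n)%N ->
  ('X - y%:P) * (\sum_(1 <= k < n.+1) (Qpoly A a i.+1 k n).[y] *: P k.-1) =
  (Qpoly A a i.+1 n n).[y] *: P n - (\det (Bmx n)).[y] *: P (n - i.+1)%N.
Proof.
move=> ltin; pose K l := (cofactor (Bmx n) l i).[y].
have QE k : (Qpoly A a i.+1 k n).[y] = \sum_(l < r) K l * (A k l ord0).[y].
  rewrite Qpoly_cofactor horner_sum; apply: eq_bigr => l _.
  by rewrite hornerM mulrC.
have -> : \sum_(1 <= k < n.+1) (Qpoly A a i.+1 k n).[y] *: P k.-1 =
    \sum_(l < r) K l *: \sum_(1 <= k < n.+1) (A k l ord0).[y] *: P k.-1.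
  under [RHS]eq_bigr do rewrite scaler_sumr.
  rewrite exchange_big; apply: eq_bigr => k _; rewrite QE scaler_suml.
  by apply: eq_bigr => l _; rewrite scalerA.
rewrite mulr_sumr.
under eq_bigr do rewrite -scalerAr christoffel_darboux scalerBr scalerA.
rewrite sumrB -scaler_suml -QE; congr (_ - _).
under eq_bigr do rewrite scaler_sumr.
rewrite exchange_big /= big_add1 /= big_mkord.
have imin : (i < minn r n)%N by rewrite leq_min ltn_ord ltin.
rewrite (bigD1 (Ordinal imin))//= [X in _ + X]big1 ?addr0 => [|c ci].
  under eq_bigr do rewrite scalerA.
  rewrite -scaler_suml; congr (_ *: _).
  have := Bvec_cofactor i i n; rewrite eqxx mulr1n => <-.
  by rewrite horner_sum; apply: eq_bigr => l _; rewrite hornerM mulrC.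
under eq_bigr do rewrite scalerA.
rewrite -scaler_suml.
have cr : (c < r)%N by apply: leq_trans (ltn_ord c) (geq_minl _ _).
have := Bvec_cofactor i (Ordinal cr) n.
rewrite (_ : (i == Ordinal cr) = false) => [/=|]; last first.
  by apply/eqP => ic; move/eqP: ci; apply; apply/val_inj; rewrite /= ic.
move=> /(congr1 (horner^~ y)); rewrite /= horner0 horner_sum => B0.
rewrite [X in X *: _](_ : _ = 0) ?scale0r//; apply: (etrans _ B0).
by apply: eq_bigr => l _; rewrite hornerM mulrC.
Qed.

(* The value at x = y of the identity above, whose left-hand side vanishes. *)
Lemma Qpoly_diag n (i : 'I_r) : (i < n)%N ->
  Qpoly A a i.+1 n n * P n = \det (Bmx n) * P (n - i.+1)%N.
Proof.
move=> ltin; apply: poly_eq_horner => y.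
have /(congr1 (horner^~ y)) := christoffel_darboux_Qpoly y ltin.
by rewrite /= !hornerE subrr mul0r => /esym/eqP; rewrite subr_eq0 => /eqP.
Qed.

(* By BvecS, subtracting multiples of the first column A n.+1 turns the columns
   of Q^(1) into A n.+1, B_n^(1), ..., B_n^(r-1), and a_(n,r) A n.+1 = B_n^(r). *)
Lemma Qpoly1_diag n :
  (a n r)%:P * Qpoly A a 1 n.+1 n.+1 = (-1) ^+ r' * \det (Bmx n).
Proof.
pose X : 'M[{poly C}]_r :=
  \matrix_(l < r, c < r) (if c == ord0 then A n.+1 l ord0 else Bvec A a n c l ord0).
have -> : Qpoly A a 1 n.+1 n.+1 = \det X.
  (* Right multiplication by this unipotent matrix subtracts [a n j] times the first column from
     each column [j > 0]. *)
  pose U : 'M[{poly C}]_r :=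
    \matrix_(i < r, j < r) ((i == j)%:R - (a n j)%:P *+ ((i == ord0) && (j != ord0))).
  have detU : \det U = 1.
    rewrite -det_tr det_trig; last first.
      apply/is_trig_mxP => i j ij; rewrite !mxE.
      have -> : (j == i) = false by exact: gtn_eqF.
      have -> : (j == ord0) = false by apply/negbTE; rewrite -lt0n (leq_trans _ ij).
      by rewrite subr0.
    by rewrite big1// => i _; rewrite !mxE eqxx andbN subr0.
  rewrite -[\det X]mulr1 -detU -det_mulmx.
  congr (\det _); apply/matrixP => l c; rewrite !mxE eqSS.
  under eq_bigr do rewrite !mxE mulrBr.
  rewrite sumrB (bigD1 c)//= eqxx mulr1 big1 ?addr0 => [|j jc]; last first.
    by rewrite (negbTE jc) mulr0.
  case: (eqVneq c ord0) => [->|c0].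
    by rewrite eqxx big1 ?subr0// => j _; rewrite andbF mulr0n mulr0.
  have -> : (c == 0 :> nat)%N = false by exact: negbTE.
  rewrite (bigD1 ord0)//= big1 => [|j j0].
    by rewrite addr0 mulr1n BvecS ?(ltnW (ltn_ord c))// !mxE mulrC.
  by rewrite (negbTE j0) mulr0n mulr0.
(* The scaled first column is [B_n^(r)], so the new matrix is a cyclic column shift of [Bmx n]. *)
have -> : (a n r)%:P * \det X =
  \det (X *m diag_mx (\row_j (if j == ord0 then (a n r)%:P else 1))).
  rewrite det_mulmx det_diag mulrC (bigD1 ord0)//= mxE eqxx big1 ?mulr1//.
  by move=> j j0; rewrite mxE (negbTE j0).
apply: det_rotate_col; apply/matrixP => l c; rewrite ?mul_mx_diag !mxE.
  rewrite [lift _ _ == _](_ : _ = false) ?mulr1//=.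
  by rewrite /bump leq0n add1n [in RHS]leqNgt ltn_ord add0n.
by rewrite eqxx Bvec_top !mxE mulrC.
Qed.

(** * Evaluation of the determinant of [Bmx n] *)

Hypothesis P_neq0 : forall n, P n != 0.
Hypothesis P0 : P 0 = 1.
Hypothesis a_neq0 : forall n, (r <= n)%N -> a n r != 0.
Hypothesis sizeA : forall n (j : 'I_r), (size (A n j ord0) <= proper_index r n j)%N.

Lemma typeI_comp_eq0 k (l : 'I_r) : (k <= l)%N -> A k l ord0 = 0.
Proof.
move=> kl; apply/eqP; rewrite -size_poly_eq0 -leqn0 (leq_trans (sizeA k l))//.
by rewrite leqNgt ltn_proper_index// -leqNgt.
Qed.

Lemma typeI_comp_const (l : 'I_r) : A l.+1 l ord0 = ((A l.+1 l ord0)`_0)%:P.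
Proof.
apply: size1_polyC; rewrite (leq_trans (sizeA _ l))//.
by rewrite leqNgt ltn_proper_index// -leqNgt mul1n addSn ltnS leq_addl.
Qed.

(** For [n = 0] every coefficient has first index below the second, so the convention makes it 1. *)
Lemma Bvec_index0 (c l : 'I_r) :
  Bvec A a 0 c.+1 l ord0 = \sum_(c.+1 <= j < r.+1) A (j - c)%N l ord0.
Proof.
rewrite /Bvec summxE; apply: eq_big_nat => j /andP[cj jr].
rewrite recP.2 ?add0n; last by apply/andP; split; lia.
by rewrite polyC1 scale1r -subSn// subSS.
Qed.

(** Entry [(l, c)] sums component [l] of [A 1], ..., [A (r - c)], which vanishes up to [A l]:
    nothing remains for [r <= l + c], and only [A l.+1] on the antidiagonal. *)
Lemma det_Bmx0 : \det (Bmx 0) =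
  ((-1) ^+ 'C(r, 2) * \prod_(j < r) (A j.+1 j ord0)`_0)%:P.
Proof.
rewrite det_antitrig => [|l c lc]; last first.
  rewrite mxE Bvec_index0 big1_seq// => j.
  by rewrite mem_index_iota => /andP[_ /andP[cj jr]]; apply: typeI_comp_eq0; lia.
rewrite polyCM rmorphXn rmorphN1 rmorph_prod; congr (_ * _).
apply: eq_bigr => l _; rewrite mxE Bvec_index0 big_nat_recr; last first.
  by rewrite /=; lia.
rewrite /= -typeI_comp_const big1_seq ?add0r => [|j].
  by congr (A _ _ _); rewrite /=; have := ltn_ord l; lia.
rewrite mem_index_iota => /andP[_ /andP[cj jr]]; apply: typeI_comp_eq0.
by move: cj jr => /=; have := ltn_ord l; lia.
Qed.

Lemma top_recurrence_neq0 n : a n r != 0.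
Proof.
have [nr|] := ltnP n r; last exact: a_neq0.
by rewrite recP.2 ?oner_eq0// nr leqnn.
Qed.

(** [Qpoly_diag] at [n.+1] and [Qpoly1_diag] give [a_(n,r) P_n det M_(n+1) = (-1)^(r-1) P_(n+1) det
    M_n]; the factors [a_(n,r)] and [P_n] are then cancelled. *)
Lemma det_Bmx_signed n : \det (Bmx n) =
  ((-1) ^+ (n * r' + 'C(r, 2)) * \prod_(j < r) (A j.+1 j ord0)`_0
   / \prod_(0 <= l < n) a l r)%:P * P n.
Proof.
elim: n => [|n IHn]; first by rewrite big_geq// divr1 P0 mulr1 det_Bmx0.
have a0 : (a n r)%:P != 0 by rewrite polyC_eq0 top_recurrence_neq0.
apply: (mulfI a0); apply: (mulIf (P_neq0 n)).
have := Qpoly_diag (ltn0Sn n : (@ord0 r' < n.+1)%N); rewrite /= subSS subn0.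
move=> /(congr1 ( *%R (a n r)%:P)); rewrite !mulrA => <-.
rewrite Qpoly1_diag IHn big_nat_recr//= mulSn -addnA exprD.
have -> : (-1) ^+ r' = ((-1) ^+ r')%:P :> {poly C} by rewrite rmorphXn rmorphN1.
set p := \prod_(0 <= l < n) _; set q := \prod_(j < r) _.
have p0 : p != 0.
  by rewrite /p prodf_seq_neq0; apply/allP => l _; exact: top_recurrence_neq0.
rewrite [RHS]mulrAC !mulrA -!polyCM !exprD; congr (_%:P * _ * _).
by field; rewrite p0 top_recurrence_neq0.
Qed.

Lemma det_Bmx n : (0 < n)%N -> \det (Bmx n) = (gamma A a n)%:P * P n.
Proof.
move=> n_gt0; rewrite det_Bmx_signed; congr (_%:P * _).
rewrite /gamma.
(* The factors with [l < r] are 1 by convention. *)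
have -> : \prod_(0 <= l < n) a l r = \prod_(r <= l < n) a l r.
  have [rn|nr] := leqP r n.
    rewrite (big_cat_nat (n := r))//= big1_seq ?mul1r// => l.
    by rewrite mem_index_iota => /andP[_ /= lr]; rewrite recP.2// lr leqnn.
  rewrite [RHS]big_geq ?(ltnW nr)// big1_seq// => l.
  rewrite mem_index_iota => /andP[_ /= ln].
  by rewrite recP.2// leqnn (ltn_trans ln nr).
rewrite [(-1) ^+ _ * _]mulrC mulrAC; congr (_ * _).
rewrite -signr_odd -[RHS]signr_odd; congr ((-1) ^+ nat_of_bool _).
have nE : n = (n.-1 %/ r * r + rem_part r n)%N.
  by rewrite /rem_part addnS -divn_eq prednK.
by rewrite {1}nE (@sign_rem r)//= ltn_pmod.
Qed.

End christoffel_darboux.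

Theorem theorem2p5 (R : realType) (r : nat) (hr : (0 < r)%N)
  (mu : 'I_r -> {charge set (plane R) -> \bar R[i]})
  (hmoments : forall j, all_moments_exist (mu j))
  (hcomplete : weakly_complete mu)
  (P : nat -> {poly R[i]})
  (hP : forall n, monic_typeII mu n (P n))
  (A : nat -> 'cV[{poly R[i]}]_r)
  (hA0 : A 0%N = 0)
  (hA : forall n, (0 < n)%N -> typeI mu n (A n))
  (a : nat -> nat -> R[i])
  (ha : recurrence_coefficients r P a)
  (n i : nat) (hn : (0 < n)%N) (hi : (1 <= i <= minn r n)%N) :
  (forall x y : R[i],
     (x - y) * (\sum_(1 <= k < n.+1) (P k.-1).[x] * (Qpoly A a i k n).[y])
     = gamma A a n * ((P n).[x] * (P (n - i)%N).[y]
                      - (P n).[y] * (P (n - i)%N).[x]))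
  /\
  (forall x : R[i],
     \sum_(1 <= k < n.+1) (P k.-1).[x] * (Qpoly A a i k n).[x]
     = gamma A a n * ((P n)^`().[x] * (P (n - i)%N).[x]
                      - (P n).[x] * (P (n - i)%N)^`().[x])).
Proof.
case: r => [//|r'] in hr mu hmoments hcomplete hP A hA0 hA ha hi *.
have [L muL] : exists L : 'I_r'.+1 -> {linear {poly R[i]} -> R[i] | *%R},
    forall j, poly_integral (mu j) = L j :> (_ -> _).
  have h j := cid (poly_integral_linear (hmoments j)).
  by exists (fun j => sval (h j)) => j; exact: svalP (h j).
have P_neq0 m : P m != 0 by have [[]] := hP m.
have sizeP m : size (P m) = m.+1.
  (* Weak completeness concerns positive indices; at 0 the size is 1 because [P 0] is nonzero of
     size at most 1. *)
  have [PII _] := hP m; case: m => [|m] in PII *; last exact: hcomplete PII.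
  by case: PII => p0 /= s1 _; apply/eqP; rewrite eqn_leq s1 lt0n size_poly_eq0.
have monicP m : P m \is monic by have [] := hP m.
have P0 : P 0 = 1.
  have /size1_polyC P0 : (size (P 0) <= 1)%N by rewrite sizeP.
  have := monicP 0; rewrite P0 monicE lead_coefC => /eqP ->.
  by rewrite polyC1.
have orthoP m (j : 'I_r'.+1) l : (l < proper_index r'.+1 m j)%N ->
    L j (P m * 'X^l) = 0.
  by rewrite -muL; have [[_ _ +] _] := hP m; exact.
have sizeA m (j : 'I_r'.+1) : (size (A m j ord0) <= proper_index r'.+1 m j)%N.
  case: m => [|m]; first by rewrite hA0 mxE size_poly0.
  by have [] := hA m.+1 isT.
have vsizeA m := vsize_le_proper (sizeA m).
have dualA m l : (l <= m)%N -> pairing L 'X^l (A m.+1) = (l == m)%:R.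
  have [_ Aortho Anorm] := hA m.+1 isT.
  rewrite /pairing; under eq_bigr do rewrite -muL.
  by rewrite leq_eqVlt => /orP[/eqP->|lm]; rewrite ?eqxx// Aortho ?ltn_eqF.
have recA := typeI_recurrence sizeP monicP orthoP hA0 vsizeA dualA ha.
have a_neq0 := leading_recurrence_neq0 sizeP monicP orthoP vsizeA dualA ha.
case: i => [//|i] in hi *; move: hi; rewrite /= leq_min => /andP[ir iltn].
pose I : 'I_r'.+1 := Ordinal ir.
have detB := det_Bmx hA0 ha recA P_neq0 P0 a_neq0 sizeA hn.
(* Substitute [detB] into [Qpoly_diag] and cancel [P n]. *)
have QE : Qpoly A a i.+1 n n = (gamma A a n)%:P * P (n - i.+1)%N.
  apply: (mulIf (P_neq0 n)); rewrite (@Qpoly_diag _ _ _ _ _ hA0 ha recA n I)// detB.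
  by rewrite mulrAC.
have CD y : ('X - y%:P) *
      (\sum_(1 <= k < n.+1) (Qpoly A a i.+1 k n).[y] *: P k.-1) =
    gamma A a n *: ((P (n - i.+1)%N).[y] *: P n - (P n).[y] *: P (n - i.+1)%N).
  rewrite (@christoffel_darboux_Qpoly _ _ _ _ _ hA0 ha recA n I)// QE detB.
  by rewrite !hornerE scalerBr !scalerA.
have sumE x y : (\sum_(1 <= k < n.+1) (Qpoly A a i.+1 k n).[y] *: P k.-1).[x] =
    \sum_(1 <= k < n.+1) (P k.-1).[x] * (Qpoly A a i.+1 k n).[y].
  by rewrite horner_sum; apply: eq_bigr => k _; rewrite hornerZ mulrC.
split=> [x y|x].
  have /(congr1 (horner^~ x)) := CD y.
  rewrite /= hornerM sumE !hornerE => ->.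
  by congr (_ * (_ - _)); rewrite mulrC.
(* Since ['X - x%:P] vanishes at [x], the derivative of the product there is the sum itself. *)
have /(congr1 (fun p => p^`().[x])) := CD x.
rewrite derivM derivB derivX derivC subr0 mul1r hornerD hornerM sumE.
rewrite hornerXsubC subrr mul0r addr0 => ->.
rewrite derivZ derivB !derivZ !hornerE.
by congr (_ * (_ - _)); rewrite mulrC.
Qed.
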